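(* Let $p(X)=p_0+p_1X+\cdots+p_nX^n$ be a real polynomial of degree $n$ ($p_n\neq0$), and let $p_\delta(X)=p(X)-\delta$ for $\delta\in\mathbb{R}$. Then $\mathrm{Dis}(p_\delta(X))$ is a polynomial in $\delta$ of order (degree) not greater than $n-1$.
   Context: $\mathrm{Dis}(p_\delta(X))$ is the discriminant of $p_\delta(X)$ as a polynomial in $X$ of degree $n$: for a polynomial $g$ of degree $n$ with leading coefficient $a_n$ and complex roots $\alpha_1,\dots,\alpha_n$ (listed with multiplicity), $\mathrm{Dis}(g)=a_n^{2n-2}\prod_{1\le i<j\le n}(\alpha_i-\alpha_j)^2=(-1)^{n(n-1)/2}a_n^{-1}\mathrm{Res}(g,g')$. Viewed as a function of $\delta$ it is called the hidden polynomial. *)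

(* Defs.v *)
From HB Require Import structures.
From mathcomp Require Import all_boot all_order all_algebra.
From mathcomp Require Import complex reals.

Set Implicit Arguments.
Unset Strict Implicit.
Unset Printing Implicit Defensive.

Import Order.TTheory GRing.Theory Num.Theory.
Local Open Scope ring_scope.

(* [alpha] lists the roots of [g] with multiplicity, in some order: the       *)
(* specification of [closed_field_poly_normal] is                             *)
(* [g = lead_coef g *: \prod_(z <- alpha) ('X - z%:P)]. The squared factors   *)
(* make the value independent of that order.                                  *)
(* For constant [g] the subtraction is truncated and the value is 1.          *)
Definition discriminant (F : closedFieldType) (g : {poly F}) : F :=
  let n := (size g).-1 in
  let alpha := sval (closed_field_poly_normal g) in
  lead_coef g ^+ (2 * n - 2) *
  \prod_(i < n) \prod_(j < n | (i < j)%N) (alpha`_i - alpha`_j) ^+ 2.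

Definition Dis (R : realType) (g : {poly R}) : R[i] :=
  discriminant (map_poly (real_complex R) g).

(* Main.v *)
Require Import Defs.
From HB Require Import structures.
From mathcomp Require Import all_boot all_order all_algebra.
From mathcomp Require Import complex reals.
From mathcomp Require Import ring.

Set Implicit Arguments.
Unset Strict Implicit.
Unset Printing Implicit Defensive.

Import Order.TTheory GRing.Theory Num.Theory.
Local Open Scope ring_scope.

(** Why the discriminant of [p - delta] has degree at most [n - 1] in [delta].
    Up to sign and a power of the leading coefficient [a], the discriminant of
    [g] is the product of [g'] over the roots of [g]
    ([horner_deriv_prod_XsubC], [prodr_ltn_sqr]). Exchanging the roles of [g]
    and [g'], as in the symmetry of the resultant, turns it into a constant
    times the product of [g] over the [n - 1] critical points of [g]. For [g = p - delta] the
    critical points, being the roots of [p'], do not depend on [delta], and each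
    of them contributes a single factor [p(beta) - delta].

    The critical points may fail to be real, so their product is packaged in a
    real matrix: if [M] has size [n - 1] and characteristic polynomial
    [p' / (n a)] (a companion matrix), then [\det (g M)] is the product of the
    values of [g] at the critical points. Factoring [g] over its roots instead
    expresses this determinant through the values of [g'] at the roots of
    [g] ([det_horner_mx]), and so gives the discriminant ([discriminant_det]).
    Finally [\det (p M - delta)] is, up to sign, the value at [delta] of the
    characteristic polynomial of [p M], which is a real polynomial of degree
    [n - 1]. *)

Lemma horner_deriv_prod_XsubC (R : comNzRingType) n (r : 'I_n -> R) (i : 'I_n) :
  (\prod_(j < n) ('X - (r j)%:P))^`().[r i] = \prod_(j < n | j != i) (r i - r j).
Proof.
rewrite (bigD1 i) //= derivM derivXsubC mul1r !hornerE subrr mul0r addr0.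
by rewrite horner_prod; apply: eq_bigr => j _; rewrite !hornerE.
Qed.

(** Each unordered pair of indices occurs in both orders on the right, with
    opposite factors; every one of the ['C(n, 2)] pairs thus costs one sign. *)
Lemma prodr_ltn_sqr (R : comNzRingType) n (r : 'I_n -> R) :
  \prod_(i < n) \prod_(j < n | (i < j)%N) (r i - r j) ^+ 2 =
  (-1) ^+ 'C(n, 2) * \prod_(i < n) \prod_(j < n | j != i) (r i - r j).
Proof.
have split_neq i : \prod_(j < n | j != i) (r i - r j) =
    \prod_(j < n | (i < j)%N) (r i - r j) * \prod_(j < n | (j < i)%N) (r i - r j).
  rewrite (bigID (fun j : 'I_n => (i < j)%N)) /=.
  by congr (_ * _); apply: eq_bigl => j; rewrite -val_eqE /=; case: ltngtP.
rewrite (eq_bigr _ (fun i _ => split_neq i)) big_split /=.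
under eq_bigr do rewrite prodrXl expr2.
rewrite big_split /= mulrCA; congr (_ * _).
rewrite (exchange_big_dep predT) //= -bin2_sum big_mkord -prodrXr -big_split /=.
apply: eq_bigr => j _.
(* the sign splits as [\sum_(j < n) j = 'C(n, 2)]: one factor per [i < j] *)
have -> : (-1) ^+ j = \prod_(i < n | (i < j)%N) (-1) :> R.
  by rewrite -(big_ord_widen n (fun=> -1)) ?prodr_const ?card_ord // ltnW.
by rewrite -big_split; apply: eq_bigr => i _ /=; rewrite mulN1r opprB.
Qed.

Lemma horner_char_poly (R : comNzRingType) n (M : 'M[R]_n) x :
  (char_poly M).[x] = \det (x%:M - M).
Proof.
rewrite -[LHS]/(horner_eval x _) -det_map_mx; congr (\det _).
by apply/matrixP => i j; rewrite !mxE /= /horner_eval !hornerE hornerMn hornerX.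
Qed.

Lemma det_subC (R : comNzRingType) n (A B : 'M[R]_n) :
  \det (A - B) = (-1) ^+ n * \det (B - A).
Proof. by rewrite -detZ scaleN1r opprB. Qed.

(** The exchange of roles between the two polynomials: a product over the
    eigenvalues of [M] of a polynomial with roots [r i] becomes a product over
    the [r i] of the characteristic polynomial of [M]. Working with determinants
    avoids splitting the characteristic polynomial. *)
Lemma det_horner_mx (R : comNzRingType) m (M : 'M[R]_m.+1) a n (r : 'I_n -> R) :
  \det (horner_mx M (a *: \prod_(i < n) ('X - (r i)%:P))) =
  a ^+ m.+1 * \prod_(i < n) ((-1) ^+ m.+1 * (char_poly M).[r i]).
Proof.
rewrite linearZ /= detZ rmorph_prod; congr (_ * _).
rewrite (big_morph determinant (@det_mulmx _ _) (@det1 _ _)).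
apply: eq_bigr => i _.
by rewrite rmorphB /= horner_mx_X horner_mx_C det_subC horner_char_poly.
Qed.

(** The hypothesis makes the eigenvalues of [M] the critical points of [g], so
    this is the discriminant as a product of critical values. Since [M] is tied
    to [g] only through [g'] and the leading coefficient, one [M] serves all
    translates [g - delta]. *)
Lemma discriminant_det (F : closedFieldType) m (g : {poly F}) (M : 'M[F]_m.+1) :
  size g = m.+3 -> g^`() = (m.+2%:R * lead_coef g) *: char_poly M ->
  discriminant g = (-1) ^+ 'C(m.+2, 2) * m.+2%:R ^+ m.+2 *
                   lead_coef g ^+ m.+1 * \det (horner_mx M g).
Proof.
move=> sz_g dg; rewrite /discriminant sz_g /=.
case: closed_field_poly_normal => rs /= g_rs; set a := lead_coef g in dg g_rs *.
have a0 : a != 0 by rewrite lead_coef_eq0 -size_poly_eq0 sz_g.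
have sz_rs : size rs = m.+2.
  by move: sz_g; rewrite g_rs size_scale // size_prod_XsubC => -[].
have {}g_rs : g = a *: \prod_(i < m.+2) ('X - (rs`_i)%:P).
  by rewrite [LHS]g_rs (big_nth 0) sz_rs big_mkord.
have roots i : \prod_(j < m.+2 | j != i) (rs`_i - rs`_j) =
    m.+2%:R * (char_poly M).[rs`_i].
  apply: (mulfI a0).
  rewrite -(horner_deriv_prod_XsubC (fun i : 'I_m.+2 => rs`_i)).
  by rewrite -[LHS]hornerZ -derivZ -g_rs dg hornerZ mulrCA mulrA.
rewrite (prodr_ltn_sqr (fun i : 'I_m.+2 => rs`_i)).
rewrite (eq_bigr _ (fun i _ => roots i)) g_rs det_horner_mx !big_split /=.
rewrite !prodr_const card_ord.
(* the exponent is a product of two consecutive integers *)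
have -> : ((-1) ^+ m.+1) ^+ m.+2 = 1 :> F.
  by rewrite -exprM -signr_odd oddM /= andbN.
have -> : (2 * m.+2 - 2 = m.+1 + m.+1)%N by rewrite mul2n doubleS subn2 addnn.
by rewrite exprD; ring.
Qed.

Lemma char_poly_surj (R : comNzRingType) n (q : {poly R}) :
  q \is monic -> size q = n.+1 -> exists M : 'M[R]_n, char_poly M = q.
Proof.
move=> q_monic sz_q; have -> : n = (size q).-1 by rewrite sz_q.
by exists (companionmx q); apply: companionmxK.
Qed.

Lemma size_sub_const (R : nzRingType) n (p : {poly R}) c :
  size p = n.+2 -> size (p - c%:P) = n.+2 /\ lead_coef (p - c%:P) = lead_coef p.
Proof.
move=> sz_p; have lt_c : (size (- c%:P) < size p)%N.
  by rewrite size_polyN sz_p (leq_ltn_trans (size_polyC_leq1 c)).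
by rewrite size_polyDl // lead_coefDl.
Qed.

(** Characteristic zero is what keeps the top coefficient of the derivative
    from vanishing. *)
Lemma deriv_size_lead (R : numDomainType) n (p : {poly R}) :
  size p = n.+2 -> size p^`() = n.+1 /\ lead_coef p^`() = n.+1%:R * lead_coef p.
Proof.
move=> sz_p; have p0 : p != 0 by rewrite -size_poly_eq0 sz_p.
have top : p^`()`_n = n.+1%:R * lead_coef p.
  by rewrite coef_deriv lead_coefE sz_p mulr_natl.
have top0 : p^`()`_n != 0 by rewrite top mulf_neq0 ?pnatr_eq0 ?lead_coef_eq0.
have sz_dp : size p^`() = n.+1.
  apply/eqP; rewrite eqn_leq -ltnS -sz_p lt_size_deriv //= ltnNge.
  by apply: contra top0 => /leq_sizeP->.
by rewrite lead_coefE sz_dp.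
Qed.

Theorem proposition1 (R : realType) (n : nat) (p : {poly R})
    (hn : (0 < n)%N) (hp : size p = n.+1) :
  exists D : {poly R},
    (size D <= n)%N /\
    forall delta : R, Dis (p - delta%:P) = real_complex R D.[delta].
Proof.
case: n hn hp => [//|[|m]] _ sz_p.
  (* [horner_mx] asks for a nonempty matrix, but a polynomial of degree one has
     no critical point; its discriminant is an empty product. *)
  exists 1; split=> [|delta]; first by rewrite size_poly1.
  have [sz_pd _] := size_sub_const delta sz_p.
  rewrite /Dis /discriminant size_map_poly sz_pd expr0 mul1r hornerC rmorph1.
  by rewrite big_ord1 big_pred0 // => -[[]].
set a := lead_coef p; set N : R := m.+2%:R.
have a0 : a != 0 by rewrite lead_coef_eq0 -size_poly_eq0 sz_p.
have Na0 : N * a != 0 by rewrite mulf_neq0 // pnatr_eq0.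
have [sz_dp lead_dp] := deriv_size_lead sz_p.
have [M char_M] : exists M : 'M[R]_m.+1, char_poly M = (N * a)^-1 *: p^`().
  apply: char_poly_surj; last by rewrite size_scale ?invr_eq0.
  by rewrite monicE lead_coefZ lead_dp mulVf.
pose c := (-1) ^+ 'C(m.+2, 2) * N ^+ m.+2 * a ^+ m.+1.
exists ((c * (-1) ^+ m.+1) *: char_poly (horner_mx M p)).
split=> [|delta].
  by rewrite (leq_trans (size_scale_leq _ _)) // size_char_poly.
have [sz_pd lead_pd] := size_sub_const delta sz_p.
rewrite hornerZ horner_char_poly -(mulrA c) -det_subC -(horner_mx_C M) -rmorphB /=.
rewrite /Dis (discriminant_det (M := map_mx (real_complex R) M)).
- rewrite lead_coef_map lead_pd -map_horner_mx det_map_mx.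
  by rewrite /c 3!rmorphM !rmorphXn rmorphN1 rmorph_nat.
- by rewrite size_map_poly.
rewrite lead_coef_map lead_pd -map_char_poly char_M deriv_map derivB derivC subr0.
by rewrite -(rmorph_nat (real_complex R)) -rmorphM -map_polyZ scalerA divff // scale1r.
Qed.
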